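(* Let $\lambda$ be a regular uncountable cardinal, $p$ a prime, $\mathbf t$ the $p$-type, $\overline C=\langle c_\delta:\delta\in S\rangle$ a club guessing sequence on $\lambda$, and for each $\delta\in S$ let $A_\delta\subseteq c_\delta$ be a set of order type $\omega$. Then there is a torsion-free homogeneous group $G$ of type $\mathbf t$ and cardinality $\lambda$, and a $\lambda$-filtration $\overline G$ of $G$, such that $A_\delta\in P_\delta(\overline G,\overline C)$ for every $\delta\in S$.
   Context: Groups are abelian. Let $p_1,p_2,\dots$ enumerate the primes. For $g$ in a torsion-free group $G$, the $q$-height of $g$ is the largest $k$ with $g\in q^kG$ ($\infty$ if $g\in q^kG$ for all $k$); the characteristic of $g$ is $(k_1,k_2,\dots)$ with $k_l$ the $p_l$-height of $g$. A type is an equivalence class of characteristics, two characteristics being equivalent if they differ in only finitely many coordinates and only at coordinates where both are finite. $G$ is homogeneous of type $\mathbf t$ if every nonzero element has type $\mathbf t$. The $p$-type is the type of the characteristic that is $0$ at the coordinate of $p$ and $\infty$ at all other coordinates. A club guessing sequence on $\lambda$ is $\overline C=\langle c_\delta:\delta\in S\rangle$ with $S\subseteq\lambda$ stationary, $c_\delta\subseteq\delta$, $\sup c_\delta=\delta$, such that for every closed unbounded $E\subseteq\lambda$ the set $\{\delta\in S:c_\delta\subseteq E\}$ is stationary. A $\lambda$-filtration of $G$ ($|G|=\lambda$) is a sequence $\langle G_\alpha:\alpha<\lambda\rangle$ of subgroups with $G_\alpha\subseteq G_{\alpha+1}$, $|G_\alpha|<\lambda$, $G_\alpha=\bigcup_{\beta<\alpha}G_\beta$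 for limit $\alpha$, $G=\bigcup_\alpha G_\alpha$. For $m\ge1$, $mG=\{mg:g\in G\}$. For $\delta\in S$ with increasing enumeration $\langle\alpha_i:i<i^*\rangle$ of $c_\delta$ and $g\in G$, $\mathrm{Inv}_{\overline G}(g,c_\delta)=\{\alpha_i:i<i^*,\ \exists m\ge1,\ g\in(G_{\alpha_{i+1}}+mG)\setminus(G_{\alpha_i}+mG)\}$, and $P_\delta(\overline G,\overline C)=\{\mathrm{Inv}_{\overline G}(g,c_\delta):g\in G\}$. *)

(* Defs.v *)
From mathcomp Require Import all_boot all_order all_algebra.
From mathcomp Require Import boolp classical_sets functions cardinality.
From mathcomp Require Import set_interval wochoice.

Set Implicit Arguments.
Unset Strict Implicit.
Unset Printing Implicit Defensive.

Import Order.TTheory GRing.Theory.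
Local Open Scope order_scope.
Local Open Scope card_scope.
Local Open Scope classical_set_scope.

Definition card_lt (T U : Type) (A : set T) (B : set U) : Prop :=
  A #<= B /\ A #!= B.

(** A cardinal [lambda] is represented by a well-ordered type [L] in the role
    of the initial ordinal of [lambda]: the elements of [L] are the ordinals
    below [lambda], and an ordinal [a], seen as the set of its predecessors, is
    the interval []-oo, a[]. *)
Section Ordinals.
Variables (d : Order.disp_t) (L : orderType d).
Implicit Types (a b x : L) (X E S : set L).

Definition cofinal X : Prop := forall a, exists2 x, X x & a <= x.

Definition regular_uncountable_cardinal : Prop :=
  [/\ well_order (<=%O : rel L),
      forall a, card_lt `]-oo, a[ [set: L],
      forall X, cofinal X -> X #= [set: L] &
      ~ countable [set: L]].

(** [b] is the least element of [X] above the element [a] of [X].  If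
    [alpha_i] is the increasing enumeration of [X], this says that
    [a = alpha_i] and [b = alpha_(i+1)] for some [i]. *)
Definition next_in X a b : Prop :=
  [/\ X a, X b, a < b & forall x, X x -> a < x -> b <= x].

Definition is_succ a b : Prop := next_in [set: L] a b.

Definition is_limit a : Prop :=
  (exists b, b < a) /\ ~ (exists b, is_succ b a).

(** [supremums X a] means [sup X = a]. *)
Definition club E : Prop :=
  cofinal E /\
  forall a, is_limit a -> supremums (E `&` `]-oo, a[) a -> E a.

Definition stationary S : Prop := forall E, club E -> (S `&` E) !=set0.

Definition club_guessing S (c : L -> set L) : Prop :=
  [/\ stationary S,
      forall delta, S delta -> c delta `<=` `]-oo, delta[,
      forall delta, S delta -> supremums (c delta) delta &
      forall E, club E -> stationary [set delta | S delta /\ c delta `<=` E]].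

Definition order_type_omega X : Prop :=
  exists2 e : nat -> L,
    {homo e : m n / (m < n)%N >-> m < n} & X = range e.

End Ordinals.

Local Open Scope ring_scope.
Local Open Scope classical_set_scope.

Section Types.

(** The enumeration of the primes is immaterial, so characteristics are indexed
    by the primes themselves.  [None] stands for infinity. *)
Definition prime_number : Type := {q : nat | prime q}.

Definition characteristic : Type := prime_number -> option nat.

Definition char_equiv (k l : characteristic) : Prop :=
  finite_set [set q | k q <> l q] /\
  forall q, k q <> l q -> k q <> None /\ l q <> None.

Definition type_of_char (k : characteristic) : set characteristic :=
  [set l | char_equiv k l].

Definition p_type (p : nat) : set characteristic :=
  type_of_char (fun q => if val q == p then Some 0%N else None).

End Types.

Section Groups.
Variable G : zmodType.
Implicit Types (g : G) (H K : set G) (m q : nat).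

Definition torsion_free : Prop :=
  forall g m, (0 < m)%N -> g *+ m = 0 -> g = 0.

(** The subgroup [m G]. *)
Definition multiples m : set G := range (fun g => g *+ m).

Definition height q g : option nat :=
  if `[< forall k, multiples (q ^ k)%N g >] then None
  else Some (xget 0%N [set k | multiples (q ^ k)%N g /\
                               forall j, multiples (q ^ j)%N g -> (j <= k)%N]).

Definition char_of g : characteristic := fun r => height (val r) g.

Definition homogeneous (t : set characteristic) : Prop :=
  forall g, g != 0 -> type_of_char (char_of g) = t.

Definition subgroup H : Prop := zmod_closed (fun g => g \in H).

Definition sum_set H K : set G := [set h + k | h in H & k in K].

Variables (d : Order.disp_t) (L : orderType d).

Definition filtration (Gs : L -> set G) : Prop :=
  [/\ [set: G] #= [set: L],
      forall a, subgroup (Gs a) /\ card_lt (Gs a) [set: L],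
      forall a b, is_succ a b -> Gs a `<=` Gs b,
      forall a, is_limit a -> Gs a = \bigcup_(b in `]-oo, a[) Gs b &
      [set: G] = \bigcup_(a in [set: L]) Gs a].

Definition Inv (Gs : L -> set G) g (c : set L) : set L :=
  [set a | exists2 b, next_in c a b &
     exists2 m, (1 <= m)%N &
       (sum_set (Gs b) (multiples m) `\` sum_set (Gs a) (multiples m)) g].

Definition P_set (Gs : L -> set G) (c : set L) : set (set L) :=
  [set Inv Gs g c | g in [set: G]].

End Groups.

Arguments torsion_free : clear implicits.
Arguments homogeneous : clear implicits.

(* Main.v *)
(** Let [e_delta] enumerate [A delta] increasingly.  Inside the group of functions
    from [L] to the rationals, let [x_a] be the indicator of the point [a] and,
    for [delta] in [S], let [y_(delta,k)] be the sum over [n >= k] of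
    [p^(n-k) x_(e_delta n)].  Take for [G] the span of all these functions over
    the rationals with denominator prime to [p], and for [G_a] the span of those
    with index [a'] or [delta] strictly below [a].  All values of elements of [G]
    have denominator prime to [p], so nonzero elements have finite [p]-height;
    division by other primes is built in.  An element of [G_a] vanishes at every
    [b >= a], while modulo [p^k G] the element [y_(delta,0)] is the sum over
    [n < k] of [p^n x_(e_delta n)].  Hence [y_(delta,0)] lies in [G_a + m G] if
    and only if [e_delta n < a] for all [n] smaller than the exponent of [p] in
    [m], and the invariant of [y_(delta,0)] along [c delta] is [A delta].  That
    [G_a] has cardinality less than [lambda] follows from the equality of an
    infinite cardinal with its square. *)

Require Import Defs.
From HB Require Import structures.
From mathcomp Require Import all_boot all_order all_algebra.
From mathcomp Require Import boolp classical_sets functions cardinality.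
From mathcomp Require Import set_interval wochoice ring.

Set Implicit Arguments.
Unset Strict Implicit.
Unset Printing Implicit Defensive.

Import Order.TTheory GRing.Theory Num.Theory.

Local Open Scope classical_set_scope.
Local Open Scope card_scope.

(** * Squares of infinite cardinals *)

(** The union of the empty chain is [set0], which may fail [P] or not contain [R0]. So Zorn's lemma
    is applied to [Q], which adjoins [set0] to the members of [P] above [R0]. *)
Lemma Zorn_bigcup_above (T : Type) (P : set (set T)) (R0 : set T) :
  P R0 ->
  (forall F : set (set T), F `<=` P -> F !=set0 -> total_on F subset ->
    P (\bigcup_(X in F) X)) ->
  exists M, [/\ P M, R0 `<=` M & forall N, M `<` N -> ~ P N].
Proof.
move=> PR0 Pchain.
pose Q (X : set T) := X = set0 \/ (P X /\ R0 `<=` X).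
have [F FQ Ftot|M [QM Mmax]] := @Zorn_bigcup T Q.
  have [[X [FX X0]]|Fnil] := pselect (exists X, F X /\ X !=set0); last first.
    left; apply/seteqP; split=> // x [X FX Xx].
    by apply: Fnil; exists X; split=> //; exists x.
  pose F' := [set Y | F Y /\ Y !=set0].
  have -> : \bigcup_(Y in F) Y = \bigcup_(Y in F') Y.
    apply/seteqP; split=> x [Y FY Yx]; exists Y => //; last by case: FY.
    by split=> //; exists x.
  have F'P Y : F' Y -> P Y /\ R0 `<=` Y.
    by case=> FY [y Yy]; case: (FQ _ FY) => // Y0; rewrite Y0 in Yy.
  right; split; last by move=> x R0x; exists X => //; exact: (F'P X _).2.
  apply: Pchain; [by move=> Y /F'P[]|by exists X|].
  by move=> Y Z [FY _] [FZ _]; exact: Ftot.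
(* If the maximal [M] is empty, maximality forces [R0] to be empty too, and [R0] itself is the
   wanted set. *)
case: QM => [M0|[PM R0M]]; last first.
  exists M; split=> // N MN PN; apply: (Mmax _ MN); right; split=> //.
  exact: subset_trans R0M (properW MN).
have [R00|/set0P [x R0x]] := eqVneq R0 set0.
  rewrite M0 -R00 in Mmax *; exists R0; split=> // N R0N PN.
  apply: (Mmax _ R0N); right; split=> //; exact: properW.
exfalso; apply: (Mmax R0); last by right; split.
by rewrite M0; split=> // /(_ x R0x).
Qed.

Lemma injection_total (T : Type) (A B : set T) :
  (exists f : T -> T, (forall x, A x -> B (f x)) /\
     forall x y, A x -> A y -> f x = f y -> x = y) \/
  (exists f : T -> T, (forall x, B x -> A (f x)) /\
     forall x y, B x -> B y -> f x = f y -> x = y).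
Proof.
pose P (R : set (T * T)) :=
  [/\ forall x y, R (x, y) -> A x /\ B y,
      forall x y y', R (x, y) -> R (x, y') -> y = y' &
      forall x x' y, R (x, y) -> R (x', y) -> x = x'].
have [//|F FP _ Ftot|M [[MAB Mfun Minj] _ Mmax]] := @Zorn_bigcup_above _ P set0.
  have join p q : (\bigcup_(X in F) X) p -> (\bigcup_(X in F) X) q ->
      exists X, [/\ P X, X p & X q].
    move=> [X FX Xp] [Y FY Yq]; case: (Ftot X Y FX FY) => XY.
      by exists Y; split; [exact: FP|exact: XY|exact: Yq].
    by exists X; split; [exact: FP|exact: Xp|exact: XY].
  split=> [x y [X /FP[XAB _ _] /XAB]//|x y y' p q|x x' y p q];
    have [X [[_ Xfun Xinj] Xp Xq]] := join _ _ p q.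
  - exact: Xfun Xp Xq.
  - exact: Xinj Xp Xq.
have [Mtot|/existsNP[x0 Hx0]] := pselect (forall x, exists y, A x -> M (x, y)).
  left; have [f Hf] := choice Mtot; exists f.
  split=> [x /Hf/MAB[]//|x y Ax Ay e].
  by apply: (Minj _ _ (f x)); [exact: Hf|rewrite e; exact: Hf].
have [Mtot|/existsNP[y0 Hy0]] := pselect (forall y, exists x, B y -> M (x, y)).
  right; have [f Hf] := choice Mtot; exists f.
  split=> [x /Hf/MAB[]//|x y Ax Ay e].
  by apply: (Mfun (f x)); [exact: Hf|rewrite e; exact: Hf].
have Ax0 : A x0 by apply: contrapT => NA; apply: Hx0; exists x0.
have By0 : B y0 by apply: contrapT => NB; apply: Hy0; exists y0.
have Mx0 y : ~ M (x0, y) by move=> Mxy; apply: Hx0; exists y.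
have My0 x : ~ M (x, y0) by move=> Mxy; apply: Hy0; exists x.
exfalso; apply: (Mmax (M `|` [set (x0, y0)])).
  split=> [p Mp|]; first by left.
  by move=> /(_ (x0, y0)) sM; apply: (Mx0 y0); apply: sM; right.
split.
- by move=> x y [/MAB//|[-> ->]].
- move=> x y y' [Mxy|[-> ->]] [Mxy'|].
  + exact: Mfun Mxy Mxy'.
  + by case=> e _; rewrite e in Mxy; case: (Mx0 _ Mxy).
  + by case: (Mx0 _ Mxy').
  + by case=> ->.
- move=> x x' y [Mxy|[-> ->]] [Mxy'|].
  + exact: Minj Mxy Mxy'.
  + by case=> _ e; rewrite e in Mxy; case: (My0 _ Mxy).
  + by case: (My0 _ Mxy').
  + by case=> ->.
Qed.

Lemma infinite_sequence (T : Type) :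
  infinite_set [set: T] -> exists e : nat -> T, injective e.
Proof.
move=> /infiniteP/card_leP[e].
exists (fun n => val (e (SigSub (mem_set I : n \in [set: nat])) : [set: T])).
move=> m n /val_inj; move=> /(@inj _ _ _ e).
by rewrite !inE => /(_ Logic.I Logic.I) /(congr1 val).
Qed.

Lemma infinite_pairing (T : Type) :
  infinite_set [set: T] -> exists h : T * T -> T, injective h.
Proof.
move=> /infinite_sequence[e einj].
pose fld (R : set (T * T * T)) (x : T) :=
  exists2 q, R q & [\/ x = q.1.1, x = q.1.2 | x = q.2].
(* [P R] says that [R] is the graph of an injection of the square of its field into that field. The
   start [R0] lives on a copy of the naturals, so the field of every extension is infinite. *)
pose P (R : set (T * T * T)) :=
  [/\ forall p z z', R (p, z) -> R (p, z') -> z = z',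
      forall p p' z, R (p, z) -> R (p', z) -> p = p' &
      forall x y, fld R x -> fld R y -> exists z, R (x, y, z)].
pose R0 : set (T * T * T) :=
  [set q | exists i j, q = (e i, e j, e (choice.pickle (i, j)))].
have fldR0 x : fld R0 x -> exists i, x = e i.
  by move=> [_ [i [j ->]] /= []->]; eexists; reflexivity.
have [|F FP [X0 FX0] Ftot|M [[Mfun Minj Mtot] R0M Mmax]] :=
    @Zorn_bigcup_above _ P R0.
- split.
  + by move=> p z z' [i [j [-> ->]]] [i' [j' [/einj <- /einj <- ->]]].
  + move=> p p' z [i [j [-> ->]]] [i' [j' [-> /einj]]].
    by move=> /(pcan_inj choice.pickleK)[-> ->].
  + move=> x y /fldR0[i ->] /fldR0[j ->]; eexists; exists i, j; reflexivity.
- have join p q : (\bigcup_(X in F) X) p -> (\bigcup_(X in F) X) q ->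
      exists X, [/\ F X, X p & X q].
    move=> [X FX Xp] [Y FY Yq]; case: (Ftot X Y FX FY) => XY.
      by exists Y; split=> //; exact: XY.
    by exists X; split=> //; exact: XY.
  split.
  + move=> p z z' Up Uq; have [X [FX Xp Xq]] := join _ _ Up Uq.
    by have [Xfun _ _] := FP _ FX; exact: Xfun Xp Xq.
  + move=> p p' z Up Uq; have [X [FX Xp Xq]] := join _ _ Up Uq.
    by have [_ Xinj _] := FP _ FX; exact: Xinj Xp Xq.
  + move=> x y [p Up px] [q Uq qy]; have [X [FX Xp Xq]] := join _ _ Up Uq.
    have [_ _ Xtot] := FP _ FX; have [||z Xz] := Xtot x y.
    * by exists p.
    * by exists q.
    * by exists z, X.
pose A : set T := fld M.
have [f fM] : {f : T * T -> T & forall p, A p.1 -> A p.2 -> M (p, f p)}.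
  apply: (@choice _ _ (fun p z => A p.1 -> A p.2 -> M (p, z))) => -[x y] /=.
  have [[Ax Ay]|NA] := pselect (A x /\ A y).
    by have [z Mz] := Mtot _ _ Ax Ay; exists z.
  by exists x => Ax Ay; case: NA.
have fA x y : A x -> A y -> A (f (x, y)).
  by move=> Ax Ay; exists (x, y, f (x, y)); [exact: fM|constructor 3].
have finj x y x' y' : A x -> A y -> A x' -> A y' -> f (x, y) = f (x', y') ->
    x = x' /\ y = y'.
  move=> Ax Ay Ax' Ay' E.
  suff [-> ->] : (x, y) = (x', y') by [].
  by apply: (Minj _ _ (f (x, y))); [exact: fM|rewrite E; exact: fM].
have Ae i : A (e i).
  exists (e i, e i, e (choice.pickle (i, i))); last by constructor.
  by apply: R0M; exists i, i.
(* Two distinct points of [A] serve as tags: with [f] they embed a disjoint union of two copies of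
   [A] in [A]. *)
have e01 : e 0%N <> e 1%N by move=> /einj.
(* If [A], the field of the maximal pairing [M], absorbs its complement, then [T]
   embeds in [A]; otherwise the complement contains a copy [B] of [A], and [M]
   extends to [A `|` B] with the new pairs sent into [B]. *)
have [[j [jA jinj]]|[j [jA jinj]]] := injection_total (~` A) A.
  pose k x := if pselect (A x) is left _ then f (e 0, x) else f (e 1, j x).
  have kA x : A (k x).
    by rewrite /k; case: pselect => Ax; apply: fA => //; exact: jA.
  have kinj : injective k.
    move=> x y; rewrite /k; case: pselect => Ax; case: pselect => Ay.
    - by move=> /finj[].
    - by move=> /finj[]// ; exact: jA.
    - by move=> /finj[]//; [exact: jA|move=> /esym].
    - by move=> /finj[]//; [exact: jA|exact: jA|move=> _ /jinj; apply].
  exists (fun p => f (k p.1, k p.2)) => -[x y] [x' y'] /=.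
  by move=> /finj[]// /kinj -> /kinj ->.
pose B := j @` A.
have BA x : B x -> ~ A x by move=> [y Ay <-]; exact: jA.
(* [u] folds the union of [A] and [B] onto [A], and [tag] remembers the side, so together they are
   injective. For a pair of points, [g] packs both data into [A] and moves the result into [B] by
   [j]. *)
have [u uP] : {u : T -> T &
    forall x, (A x -> u x = x) /\ (B x -> A (u x) /\ j (u x) = x)}.
  apply: (@choice _ _
    (fun x y => (A x -> y = x) /\ (B x -> A y /\ j y = x))) => x.
  have [Ax|NAx] := pselect (A x).
    by exists x; split=> // /BA.
  have [[y Ay <-]|NBx] := pselect (B x).
    by exists y; split=> // /(jA _ Ay).
  by exists x; split.
have uA x : (A `|` B) x -> A (u x).
  by case=> [Ax|Bx]; [rewrite (uP x).1|have [] := (uP x).2 Bx].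
pose tag x := if pselect (A x) is left _ then e 0 else e 1.
have tagA x : A (tag x) by rewrite /tag; case: pselect.
have tagu x y : (A `|` B) x -> (A `|` B) y -> tag x = tag y -> u x = u y ->
    x = y.
  rewrite /tag; case: pselect => Ax; case: pselect => Ay //.
  - by move=> _ _ _; rewrite (uP x).1// (uP y).1.
  - by move=> _ _ /esym.
  - by move=> [//|Bx] [//|By] _ E; rewrite -((uP x).2 Bx).2 E ((uP y).2 By).2.
pose g p := j (f (f (tag p.1, tag p.2), f (u p.1, u p.2))).
have gB x y : (A `|` B) x -> (A `|` B) y -> B (g (x, y)).
  move=> ABx ABy; eexists; last reflexivity.
  by apply: (fA); apply: fA => //; exact: uA.
have ginj x y x' y' : (A `|` B) x -> (A `|` B) y -> (A `|` B) x' ->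
    (A `|` B) y' -> g (x, y) = g (x', y') -> (x, y) = (x', y').
  move=> ABx ABy ABx' ABy' E.
  have fuA a b : (A `|` B) a -> (A `|` B) b -> A (f (u a, u b)).
    by move=> /uA ? /uA ?; exact: fA.
  have ftA a b : A (f (tag a, tag b)) by exact: fA.
  have [] : f (tag x, tag y) = f (tag x', tag y') /\
            f (u x, u y) = f (u x', u y').
    apply: finj; [exact: ftA|exact: fuA|exact: ftA|exact: fuA|].
    by apply: jinj E; apply: fA; (exact: ftA || exact: fuA).
  move=> /finj[]// t1 t2 /finj[]; [exact: uA..|].
  by move=> u1 u2; congr pair; exact: tagu.
pose M' := M `|` [set q | [/\ (A `|` B) q.1.1, (A `|` B) q.1.2,
                           ~ (A q.1.1 /\ A q.1.2) & q.2 = g q.1]].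
have MA p z : M (p, z) -> [/\ A p.1, A p.2 & A z].
  move=> Mpz; split; exists (p, z) => //;
    by [constructor 1|constructor 2|constructor 3].
have fldM' x : fld M' x -> (A `|` B) x.
  move=> [[[a b] c] [/MA/=[Aa Ab Ac]|/=[Aa Ab _ ->]]] /= [] -> //; do ?by left.
  by right; exact: gB.
(* The extension is proper: [M] involves only points of [A], and [M'] also pairs [j (e 0)] with
   itself. *)
exfalso; apply: (Mmax M').
  split=> [p Mp|sM]; first by left.
  have Bj : B (j (e 0)) by exists (e 0).
  have : M (j (e 0), j (e 0), g (j (e 0), j (e 0))).
    by apply: sM; right; split=> /=; [right|right|case=> /BA|].
  by case/MA => /= /(BA _ Bj).
split.
- move=> p z z' [Mz|[/= p1 p2 Np ->]] [Mz'|[/= q1 q2 Nq ->]] //.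
  + exact: Mfun Mz Mz'.
  + by have [? ? _] := MA _ _ Mz; case: Nq.
  + by have [? ? _] := MA _ _ Mz'; case: Np.
- move=> p p' z [Mz|[/= p1 p2 Np ->]] [Mz'|[/= q1 q2 Nq]].
  + exact: Minj Mz Mz'.
  + move=> E; have [_ _] := MA _ _ Mz; rewrite E.
    case: (p') q1 q2 => a b /= q1 q2.
    by move/(BA _ (gB _ _ q1 q2)).
  + have [_ _] := MA _ _ Mz'; case: (p) p1 p2 => a b /= p1 p2.
    by move/(BA _ (gB _ _ p1 p2)).
  + case: p p1 p2 {Np} => a b /= p1 p2; case: p' q1 q2 {Nq} => a' b' /= q1 q2.
    exact: ginj.
- move=> x y /fldM' ABx /fldM' ABy; have [[Ax Ay]|NA] := pselect (A x /\ A y).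
    by exists (f (x, y)); left; exact: fM.
  by exists (g (x, y)); right; split.
Qed.

Lemma injective_card_le (T U : Type) (f : T -> U) :
  injective f -> [set: T] #<= [set: U].
Proof.
move=> finj; have /card_esym/card_eqPle[rf _] : range f #= [set: T].
  by apply: inj_card_eq => x y _ _; exact: finj.
exact: card_le_trans rf (card_leT _).
Qed.

(** Iterated pairing codes a list. The length is coded separately, because the code [e 0] of the
    empty list may also be that of another list. *)
Lemma card_seq_le (C : countType) (T : Type) :
  infinite_set [set: T] -> [set: seq (C * T)] #<= [set: T].
Proof.
move=> Tinf; have [h hinj] := infinite_pairing Tinf.
have [e einj] := infinite_sequence Tinf.
pose fix code (s : seq (C * T)) :=
  if s is q :: s' then h (h (e (choice.pickle q.1), q.2), code s') else e 0.
apply: (@injective_card_le _ _ (fun s => h (e (size s), code s))).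
move=> s t /hinj[/einj]; elim: s t => [|[x a] s IHs] [|[y b] t] //= [/IHs].
by move=> {}IHs /hinj[/hinj[/einj/(pcan_inj choice.pickleK) -> ->]] /IHs ->.
Qed.

(** * Rationals with denominator prime to [p] *)

Section PIntegral.
Variable p : nat.
Hypothesis p_pr : prime p.
Local Open Scope ring_scope.

(** The fraction need not be reduced, so ring operations just multiply denominators; [d] is nonzero
    because [p] divides 0. *)
Definition p_integral (x : rat) : Prop :=
  exists (n : int) (d : nat), ~~ (p %| d)%N /\ x * d%:R = n%:~R.

Lemma p_integralD x y : p_integral x -> p_integral y -> p_integral (x + y).
Proof.
move=> [n [c [pc xc]]] [m [d [pd yd]]]; exists (n * d%:Z + m * c%:Z), (c * d)%N.
rewrite Euclid_dvdM // negb_or pc pd; split=> //.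
by rewrite natrM rmorphD !rmorphM /= -xc -yd -!pmulrn; ring.
Qed.

Lemma p_integralM x y : p_integral x -> p_integral y -> p_integral (x * y).
Proof.
move=> [n [c [pc xc]]] [m [d [pd yd]]]; exists (n * m), (c * d)%N.
rewrite Euclid_dvdM // negb_or pc pd; split=> //.
by rewrite natrM rmorphM /= -xc -yd; ring.
Qed.

Lemma p_integral_nat n : p_integral n%:R.
Proof. by exists n%:Z, 1%N; rewrite Euclid_dvd1 // mulr1. Qed.

Lemma p_integralN x : p_integral x -> p_integral (- x).
Proof. by move=> [n [c [pc xc]]]; exists (- n), c; rewrite mulNr xc rmorphN. Qed.

(** The quotient is the inverse of the part of [m] prime to [p]: in the localization, [m] and its
    [p]-part differ by a unit. *)
Lemma p_integral_ppart_div m : (0 < m)%N ->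
  p_integral ((p ^ logn p m)%:R / m%:R).
Proof.
move=> m0; exists 1, (m %/ p ^ logn p m)%N; split.
  have [q pq mq] := pfactor_coprime p_pr m0.
  by rewrite {1}mq mulnK ?expn_gt0 ?prime_gt0 // -prime_coprime.
by rewrite mulrAC -natrM mulnC divnK ?pfactor_dvdnn // mulfV // pnatr_eq0 -lt0n.
Qed.

(** With [y = k / c], clearing denominators gives [n * c = k * m * d], and [c] is prime to [p]. This
    turns divisibility by [m] in the group into divisibility of the value at one point. *)
Lemma p_integral_mulrn_dvd y m d (n : int) :
  p_integral y -> y *+ m * d%:R = n%:~R -> (p ^ logn p m %| `|n|)%N.
Proof.
move=> [k [c [pc yc]]] E; rewrite -(@Gauss_dvdl _ _ c); last first.
  by rewrite coprimeXl // prime_coprime.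
have : n * c%:Z = k * (m%:Z * d%:Z).
  apply: (@intr_inj rat); rewrite !rmorphM /= -E -yc -mulr_natr.
  by rewrite -!pmulrn; ring.
move=> /(congr1 absz); rewrite !abszM /= => ->.
by rewrite dvdn_mull // dvdn_mulr // pfactor_dvdnn.
Qed.

End PIntegral.

(** * The span over the localization of the integers at [p] *)

Section Span.
Local Open Scope ring_scope.
Variables (p : nat) (L : choiceType) (gen : L * nat -> L -> rat).

Definition combination (s : seq (rat * (L * nat))) : L -> rat :=
  fun b => \sum_(u <- s) u.1 * gen u.2 b.

(** Only the first coordinate of an index is confined to [B], so all generators attached to one
    ordinal enter the filtration together. *)
Definition p_span (B : set L) : set (L -> rat) :=
  [set combination s | s in
     [set s : seq (rat * (L * nat)) |
       forall u, u \in s -> p_integral p u.1 /\ B u.2.1]].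

Lemma p_span_zmod_closed (B : set L) : zmod_closed (fun f => f \in p_span B).
Proof.
split=> [|f g].
  rewrite inE; exists [::] => //; apply/funext => b.
  by rewrite /combination big_nil.
rewrite !inE => -[s sB <-] [t tB <-].
exists (s ++ [seq (- u.1, u.2) | u <- t]).
  move=> u; rewrite mem_cat => /orP[/sB//|/mapP[v /tB[vp vB] ->]].
  by split=> //=; exact: p_integralN.
apply/funext => b; rewrite /combination big_cat big_map /=; congr (_ + _).
rewrite [RHS](_ : _ = - combination t b) // -sumrN.
by apply: eq_bigr => u _; rewrite mulNr.
Qed.

Lemma p_span_subset (A B : set L) : A `<=` B -> p_span A `<=` p_span B.
Proof.
by move=> AB f [s sA <-]; exists s => // u /sA[? /AB].
Qed.

Lemma p_span_gen (B : set L) u : prime p -> B u.1 -> p_span B (gen u).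
Proof.
move=> p_pr Bu; exists [:: (1, u)]; last first.
  by apply/funext => b; rewrite /combination big_seq1 mul1r.
by move=> v; rewrite inE => /eqP ->; split=> //; exact: p_integral_nat 1%N.
Qed.

Lemma p_span_scale (B : set L) x f : prime p -> p_integral p x -> p_span B f ->
  p_span B (fun b => x * f b).
Proof.
move=> p_pr px [s sB <-]; exists [seq (x * u.1, u.2) | u <- s].
  by move=> _ /mapP[v /sB[vp vB] ->]; split=> //=; exact: p_integralM.
apply/funext => b; rewrite /combination big_map /= mulr_sumr.
by apply: eq_bigr => u _; rewrite mulrA.
Qed.

Lemma p_span_p_integral (B : set L) f b : prime p ->
  (forall u, p_integral p (gen u b)) -> p_span B f -> p_integral p (f b).
Proof.
move=> p_pr pgen [s sB <-]; rewrite /combination big_seq.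
elim/big_ind: _ => [|x y px py|u /sB[pu _]].
- exact: p_integral_nat 0%N.
- exact: p_integralD.
- exact: p_integralM.
Qed.

Lemma p_span_eq0 (B : set L) f b :
  (forall u, B u.1 -> gen u b = 0) -> p_span B f -> f b = 0.
Proof.
move=> gen0 [s sB <-]; rewrite /combination big_seq big1 // => u /sB[_ Bu].
by rewrite gen0 // mulr0.
Qed.

Definition p_span_pred : {pred L -> rat} := fun f => f \in p_span [set: L].
HB.instance Definition _ :=
  GRing.isZmodClosed.Build (L -> rat) p_span_pred (p_span_zmod_closed [set: L]).

Record p_span_group := SpanGroup
  { p_span_val : L -> rat ; _ : p_span_val \in p_span_pred }.
HB.instance Definition _ := [isSub for p_span_val].
HB.instance Definition _ := [Choice of p_span_group by <:].
HB.instance Definition _ := [SubChoice_isSubZmodule of p_span_group by <:].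

Definition p_span_subgroup (B : set L) : set p_span_group :=
  [set g | p_span B (p_span_val g)].

Lemma p_span_valP (g : p_span_group) : p_span [set: L] (p_span_val g).
Proof. by case: g => f /= /set_mem. Qed.

Lemma p_span_valMn (g : p_span_group) n b :
  p_span_val (g *+ n) b = p_span_val g b *+ n.
Proof.
by elim: n => [//|n IHn]; rewrite !mulrS /= -IHn.
Qed.

Lemma p_span_valD (g h : p_span_group) b :
  p_span_val (g + h) b = p_span_val g b + p_span_val h b.
Proof. by []. Qed.

Lemma p_span_subgroup_zmod (B : set L) : subgroup (p_span_subgroup B).
Proof.
have [s0 sB] := p_span_zmod_closed B; split=> [|g h].
  by rewrite inE; exact/set_mem.
by rewrite !inE => /mem_set gB /mem_set hB; apply/set_mem; exact: sB.
Qed.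

(** Elements are values of finite lists over rationals, naturals and [B]. An infinite [B] absorbs
    such lists; over a finite [B] there are only countably many. *)
Lemma p_span_subgroup_small (B : set L) :
  countable (p_span_subgroup B) \/ p_span_subgroup B #<= B.
Proof.
have small : p_span_subgroup B #<= [set: seq (rat * nat * set_type B)].
  pose F (s : seq (rat * nat * set_type B)) :=
    combination [seq (u.1.1, (val u.2, u.1.2)) | u <- s].
  apply: (@card_le_trans _ _ _ (range F)); last exact: card_image_le.
  have /card_eqPle[_ le_val] :
      p_span_val @` p_span_subgroup B #= p_span_subgroup B.
    by apply: inj_card_eq => g h _ _; exact: val_inj.
  apply: card_le_trans le_val _.
  apply: subset_card_le => _ [g [s sB gs] <-]; rewrite -gs.
  suff [t <-] : exists t : seq (rat * nat * set_type B),
      [seq (u.1.1, (val u.2, u.1.2)) | u <- t] = s by exists t.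
  elim: s {gs} sB => [|[x [a i]] s IHs] sB; first by exists [::].
  have [_ /= Ba] := sB _ (mem_head _ _).
  have [|t ts] := IHs; first by move=> u us; apply: sB; rewrite inE us orbT.
  by exists ((x, i, SigSub (mem_set Ba)) :: t); rewrite /= ts.
have [Bfin|Binf] := pselect (finite_set [set: set_type B]).
  left; apply: sub_countable small _.
  have /countable_injP[f finj] := finite_set_countable Bfin.
  pose F (s : seq (rat * nat * set_type B)) := [seq (u.1, f u.2) | u <- s].
  apply: sub_countable (countableP [set: seq (rat * nat * nat)]).
  apply: (@injective_card_le _ _ F); apply: inj_map => -[x a] [y b] /= [-> fab].
  by congr pair; apply: finj fab; rewrite inE.
right; apply: card_le_trans small _; apply: card_le_trans (card_seq_le _ Binf) _.
by have /card_eqPle[] := card_setT B.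
Qed.

End Span.

(** * Regular cardinals and types *)

Section Orders.
Variables (d : Order.disp_t) (L : orderType d).
Local Open Scope order_scope.

Lemma itvNyE (a b : L) : (`]-oo, a[%classic : set L) b = (b < a) :> Prop.
Proof. by rewrite /= in_itv. Qed.

Lemma seq_strict_bound (P : set L) (s : seq L) :
  P !=set0 -> (forall b, P b -> exists2 c, P c & b < c) ->
  (forall x, x \in s -> P x) -> exists2 b, P b & forall x, x \in s -> x < b.
Proof.
move=> P0 Pnomax; elim: s => [|x s IHs] sP; first by case: P0 => b; exists b.
have [|b Pb sb] := IHs; first by move=> y ys; apply: sP; rewrite inE ys orbT.
have Px := sP x (mem_head _ _).
have [c Pc] : exists2 c, P c & Order.max x b < c.
  by apply: Pnomax; case: (leP x b).
rewrite gt_max => /andP[xc bc]; exists c => // y.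
by rewrite inE => /orP[/eqP ->//|/sb yb]; exact: lt_trans bc.
Qed.

Lemma limit_nomax (a b : L) : is_limit a -> b < a -> exists2 c, c < a & b < c.
Proof.
move=> [_ Nsucc] ba; apply: contrapT => Nc; apply: Nsucc; exists b; split=> //.
move=> x _ bx; rewrite leNgt; apply/negP => xa.
by apply: Nc; exists x.
Qed.

(** A maximum would make a singleton cofinal, hence equinumerous with the uncountable [L]. *)
Lemma regular_nomax : regular_uncountable_cardinal L ->
  forall a : L, exists b, a < b.
Proof.
move=> [_ _ cof Nctbl] a; apply: contrapT => amax; apply: Nctbl.
have : cofinal [set a].
  move=> b; exists a => //; rewrite leNgt; apply/negP => ab.
  by apply: amax; exists b.
move=> /cof/card_esym/card_eqPle[le1 _].
exact: sub_countable le1 (countable1 a).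
Qed.

Lemma countable_card_lt (T : Type) (X : set T) :
  ~ countable [set: L] -> countable X -> card_lt X [set: L].
Proof.
move=> Nctbl ctX; split.
  apply: card_le_trans ctX _; apply/infiniteP => Lfin; apply: Nctbl.
  exact: finite_set_countable.
apply/negP => /card_esym/card_eqPle[le1 _]; apply: Nctbl.
exact: sub_countable le1 ctX.
Qed.

Lemma card_le_lt_trans (T U V : Type) (X : set T) (Y : set U) (Z : set V) :
  X #<= Y -> card_lt Y Z -> card_lt X Z.
Proof.
move=> XY [YZ NYZ]; split; first exact: card_le_trans XY YZ.
apply: contra NYZ => /card_esym/card_eqPle[ZX _].
by rewrite card_eq_le YZ; exact: card_le_trans ZX XY.
Qed.

End Orders.

Section Types.
Local Open Scope ring_scope.

Lemma type_of_char_eq (k l : characteristic) :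
  char_equiv k l -> type_of_char k = type_of_char l.
Proof.
have equivC u v : char_equiv u v -> char_equiv v u.
  move=> [fin H]; split=> [|q /nesym /H[]//].
  by apply: sub_finite_set fin => q /= /nesym.
have equiv_trans u v w : char_equiv u v -> char_equiv v w -> char_equiv u w.
  move=> [fuv Huv] [fvw Hvw]; split=> [|q uw].
    apply: (@sub_finite_set _ _ ([set q | u q <> v q] `|` [set q | v q <> w q])).
      move=> q /= uw; have [uv|] := pselect (u q = v q); last by left.
      by right; rewrite -uv.
    by rewrite finite_setU.
  have [uv|Nuv] := pselect (u q = v q).
    by rewrite uv; apply: Hvw; rewrite -uv.
  have [u0 v0] := Huv _ Nuv; split=> //.
  by have [<-//|/Hvw[]] := pselect (v q = w q).
move=> kl; apply/seteqP; split=> m; [exact/equiv_trans/equivC|exact: equiv_trans].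
Qed.

(** The characteristic of [g] is infinite off [p] and finite at [p], so it differs from the one
    defining [p_type p] at most at [p]. *)
Lemma homogeneous_p_type (G : zmodType) (p : nat) :
  (forall (q : nat) (g : G), prime q -> q != p ->
     forall k, multiples (q ^ k)%N g) ->
  (forall g : G, g != 0 ->
     exists N, forall k, multiples (p ^ k)%N g -> (k <= N)%N) ->
  homogeneous G (p_type p).
Proof.
move=> divG redG g g0; apply: type_of_char_eq.
have fin_at q : val q = p -> char_of g q <> None.
  rewrite /char_of /height => ->; case: asboolP => // divg.
  by have [N /(_ N.+1 (divg _))] := redG _ g0; rewrite ltnn.
have inf_at q : val q != p -> char_of g q = None.
  move=> qp; rewrite /char_of /height; case: asboolP => // -[].
  exact: divG (valP q) qp.
have eq_p q : char_of g q <> (if val q == p then Some 0%N else None) -> val q = p.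
  by case: eqP => // /eqP /inf_at ->.
split=> [|q /[dup] /eq_p qp]; last by rewrite qp eqxx; split=> //; exact: fin_at.
have [[q0 q0p]|Nq] := pselect (exists q : prime_number, val q = p); last first.
  apply: (@sub_finite_set _ _ set0) => // q /eq_p qp; apply: Nq; by exists q.
apply: (@sub_finite_set _ _ [set q0]) => // q /eq_p qp.
by apply: val_inj; rewrite /= qp.
Qed.

End Types.

(** * The group and its filtration *)

Section Generators.
Local Open Scope ring_scope.
Variables (d : Order.disp_t) (L : orderType d) (p : nat) (S : set L).
Variable e : L -> nat -> L.
Hypothesis p_pr : prime p.
Hypothesis e_inj : forall a, S a -> injective (e a).
Hypothesis e_lt : forall a n, S a -> (e a n < a)%O.

(** The default 0 is returned when [b] is not in the range of [e a]; the test
    [e a (e_index a b) == b] in [tail] excludes that case. *)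
Definition e_index (a b : L) : nat := xget 0%N [set n | e a n = b].

Definition tail (a : L) (k : nat) (b : L) : rat :=
  if [&& `[< S a >], e a (e_index a b) == b & (k <= e_index a b)%N]
  then (p ^ (e_index a b - k))%:R else 0.

(* [gen (a, 0)] is the basis function [x_a], and [gen (a, k.+1)] is the tail
   [y_(a,k)], which is zero when [a] is not in [S]. *)
Definition gen (u : L * nat) : L -> rat :=
  if u.2 is k.+1 then tail u.1 k else fun b => (b == u.1)%:R.

Lemma e_indexE a n : S a -> e_index a (e a n) = n.
Proof.
move=> Sa; rewrite /e_index; case: xgetP => [m -> /(e_inj Sa)//|].
by move=> /(_ n) [].
Qed.

Lemma tail_at a k n : S a ->
  tail a k (e a n) = if (k <= n)%N then (p ^ (n - k))%:R else 0.
Proof. by move=> Sa; rewrite /tail e_indexE // eqxx asboolT. Qed.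

Lemma tail_eq0 a k b : (forall n, S a -> e a n <> b) -> tail a k b = 0.
Proof.
move=> Nb; rewrite /tail; case: asboolP => //= Sa.
by case: eqP => // /Nb; case.
Qed.

(** The term [n = k] is split off and [p] factored out of the rest. Iterating this in [tail_split]
    makes the infinite sum finite modulo each power of [p]. *)
Lemma tail_rec a k b : S a ->
  tail a k b = (b == e a k)%:R + p%:R * tail a k.+1 b.
Proof.
move=> Sa; have [[n <-]|Nb] := pselect (exists n, e a n = b); last first.
  rewrite !tail_eq0 ?mulr0 ?addr0; last 2 first.
  - by move=> n _ nb; apply: Nb; exists n.
  - by move=> n _ nb; apply: Nb; exists n.
  by case: eqP => // bk; case: Nb; exists k.
rewrite !tail_at // (inj_eq (e_inj Sa)).
case: (ltngtP k n) => [kn|nk|->]; last by rewrite subnn mulr0 addr0.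
- by rewrite add0r -natrM -expnS subnSK.
- by rewrite mulr0 addr0.
Qed.

Lemma tail_split a k b : S a ->
  tail a 0 b = \sum_(0 <= n < k) (p ^ n)%:R * (b == e a n)%:R
               + (p ^ k)%:R * tail a k b.
Proof.
move=> Sa; elim: k => [|k IHk]; first by rewrite big_nil add0r mul1r.
by rewrite big_nat_recr //= IHk tail_rec // expnSr natrM; ring.
Qed.

Lemma gen_p_integral u b : p_integral p (gen u b).
Proof.
case: u => a [|k] /=; first exact: p_integral_nat.
rewrite /gen /tail /=; case: ifP => _; first exact: p_integral_nat.
exact: (p_integral_nat p_pr 0).
Qed.

(** The sequence [e a] stays below [a]. Hence elements of the stage at [a] vanish from [a] on, which
    is what detects non-membership. *)
Lemma gen_support u b : (u.1 < b)%O -> gen u b = 0.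
Proof.
case: u => a [|k] /= ab; first by rewrite /gen /= gt_eqF.
apply: tail_eq0 => n Sa nb.
by have := lt_trans (e_lt n Sa) ab; rewrite nb ltxx.
Qed.

Local Notation G := (p_span_group p gen).

Definition initial (a : L) : set G := @p_span_subgroup p L gen `]-oo, a[%classic.

Lemma initial_eq0 a b (g : G) : initial a g -> (a <= b)%O -> p_span_val g b = 0.
Proof.
move=> ga ab; apply: p_span_eq0 ga => u; rewrite itvNyE => ua.
by apply: gen_support; exact: lt_le_trans ab.
Qed.

Lemma p_span_group_p_integral (g : G) b : p_integral p (p_span_val g b).
Proof.
apply: p_span_p_integral (p_span_valP g) => // u; exact: gen_p_integral.
Qed.

Definition to_group f (fG : p_span p gen [set: L] f) : G :=
  SpanGroup (mem_set fG).

Lemma to_groupE f (fG : p_span p gen [set: L] f) b :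
  p_span_val (to_group fG) b = f b.
Proof. by []. Qed.

(** * Torsion-freeness and homogeneity *)

Lemma p_span_group_torsion_free : torsion_free G.
Proof.
move=> g m m0 gm; apply: val_inj; apply/funext => b /=.
have := p_span_valMn g m b; rewrite gm -[LHS]/0 => /esym/eqP.
by rewrite mulrn_eq0 eqn0Ngt m0 /= => /eqP.
Qed.

Lemma p_span_group_div (g : G) m : ~~ (p %| m)%N -> multiples m g.
Proof.
move=> pm; have m0 : (0 < m)%N by case: m pm; rewrite ?dvdn0.
have pmV : p_integral p m%:R^-1.
  by exists 1, m; split=> //; rewrite mulVf // pnatr_eq0 -lt0n.
have := p_span_scale p_pr pmV (p_span_valP g) => hG.
exists (to_group hG) => //; apply: val_inj; apply/funext => b.
rewrite [LHS]p_span_valMn -[LHS]mulr_natl to_groupE mulrA mulfV ?mul1r //.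
by rewrite pnatr_eq0 -lt0n.
Qed.

Lemma p_span_group_homogeneous : homogeneous G (p_type p).
Proof.
apply: homogeneous_p_type => [q g q_pr qp k|g g0].
  apply: p_span_group_div; rewrite Euclid_dvdX // dvdn_prime2 // eq_sym.
  by rewrite (negPf qp).
have [b gb] : exists b, p_span_val g b != 0.
  apply: contrapT => Nb; move/eqP: g0; apply; apply: val_inj; apply/funext => b.
  by apply/eqP/negPn/negP => gb; apply: Nb; exists b.
have [n [c [pc gc]]] := p_span_group_p_integral g b.
have n0 : (0 < `|n|)%N.
  rewrite absz_gt0; apply: contraNneq gb => n0; move: gc; rewrite n0 => /eqP.
  rewrite mulf_eq0 pnatr_eq0 => /orP[//|/eqP c0].
  by rewrite c0 dvdn0 in pc.
(* If [g] is divisible by [p ^ k], then [p ^ k] divides the numerator [n] of its nonzero value at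
   [b]; this bounds the height. *)
exists (logn p `|n|) => k [h _ hg].
have := p_integral_mulrn_dvd p_pr (p_span_group_p_integral h b)
  (m := p ^ k) (d := c).
move=> /(_ n); rewrite -p_span_valMn hg => /(_ gc).
by rewrite pfactorK // pfactor_dvdn.
Qed.

(** * Invariants of the infinite sums *)

Definition basis_elt (a : L) : G :=
  to_group (p_span_gen gen (B := [set: L]) (u := (a, 0%N)) p_pr Logic.I).

(** By the shift in [gen], index 1 is the tail from 0, that is, the full sum. *)
Definition omega_sum (a : L) : G :=
  to_group (p_span_gen gen (B := [set: L]) (u := (a, 1%N)) p_pr Logic.I).

Lemma basis_elt_inj : injective basis_elt.
Proof.
move=> a b /(congr1 (fun g => p_span_val g a)) /=; rewrite /gen /= eqxx.
by case: eqP => // _ /eqP; rewrite oner_eq0.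
Qed.

(** The first [k] terms lie in the stage at [b]. The remainder is [p ^ k] times a tail, a multiple
    of [m] because [p ^ k / m] is [p]-integral. *)
Lemma omega_sum_mem a b m k : S a -> (0 < m)%N -> k = logn p m ->
  (forall n, (n < k)%N -> (e a n < b)%O) ->
  sum_set (initial b) (multiples m) (omega_sum a).
Proof.
move=> Sa m0 km eb.
pose f (c : L) : rat := \sum_(0 <= n < k) (p ^ n)%:R * (c == e a n)%:R.
have fb : p_span p gen `]-oo, b[%classic f.
  exists [seq ((p ^ n)%:R, (e a n, 0%N)) | n <- index_iota 0 k].
    move=> u /mapP[n]; rewrite mem_index_iota => nk ->; split.
      exact: p_integral_nat.
    by rewrite itvNyE; exact: eb.
  by apply/funext => c; rewrite /combination big_map.
have fG := p_span_subset (@subsetT _ _) fb.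
have tG : p_span p gen [set: L] (gen (a, k.+1)) by exact: p_span_gen.
have hG := p_span_scale p_pr (p_integral_ppart_div p_pr m0) tG.
exists (to_group fG) => //; exists (to_group hG *+ m).
  by exists (to_group hG).
apply: val_inj; apply/funext => c.
rewrite [LHS]p_span_valD p_span_valMn [RHS](tail_split k c Sa).
rewrite !to_groupE -[_ * _ *+ m]mulr_natl mulrA -km; congr (_ + _ * _).
by rewrite mulrC mulfVK // pnatr_eq0 -lt0n.
Qed.

(** At the point [e a n] the summand from the stage at [b] vanishes, so [p ^ n] is [m] times a
    [p]-integral number. *)
Lemma omega_sum_memP a b m n : S a ->
  sum_set (initial b) (multiples m) (omega_sum a) ->
  (b <= e a n)%O -> (logn p m <= n)%N.
Proof.
move=> Sa [h hb [_ [g _ <-] hg]] bn.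
have : p_span_val g (e a n) *+ m * 1%N%:R = (p ^ n)%N%:~R.
  rewrite mulr1 -p_span_valMn -[LHS]add0r -(initial_eq0 hb bn) -p_span_valD hg /=.
  by rewrite /gen /= tail_at // subn0.
move=> /(p_integral_mulrn_dvd p_pr (p_span_group_p_integral g _)) /=.
by rewrite dvdn_Pexp2l // prime_gt1.
Qed.

Lemma Inv_omega_sum a (c : set L) : well_order (<=%O : rel L) -> S a ->
  {homo e a : m n / (m < n)%N >-> (m < n)%O} -> range (e a) `<=` c ->
  Defs.Inv initial (omega_sum a) c = range (e a).
Proof.
move=> Lwo Sa e_mono ec; apply/seteqP; split=> x.
  move=> [y [cx cy xy next] [m m0 [memy Nmemx]]].
  (* A term [e a n] not below [x] differs from [x], so it lies at or above the successor [y] of [x]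
     in [c], and membership at [y] gives [logn p m <= n]. Hence the terms with smaller [n] all lie
     below [x], and membership holds already at [x]. *)
  apply: contrapT => Nx; apply: Nmemx; apply: omega_sum_mem => // n nm.
  rewrite ltNge; apply/negP; rewrite le_eqVlt => /orP[/eqP xn|xn].
    by apply: Nx; exists n.
  have yn := next _ (ec _ (imageT _ _)) xn.
  by have := omega_sum_memP Sa memy yn; rewrite leqNgt nm.
move=> [n _ <-].
(* The successor of [e a n] in [c] exists because [e a n.+1] lies in [c] above it. *)
have [|y [[/andP[/asboolP cy ny] ymin] _]] :=
    Lwo (fun y => `[< c y >] && (e a n < y)%O).
  exists (e a n.+1); apply/andP; split; last exact: e_mono.
  by apply/asboolP; apply: ec; exists n.+1.
exists y; first split => //; first by apply: ec; exists n.
  move=> z cz nz; apply: ymin; apply/andP; split=> //; exact/asboolP.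
have logpn : logn p (p ^ n.+1) = n.+1 by rewrite pfactorK.
(* Modulo [p ^ n.+1] the sum keeps the terms up to [e a n]: all are below [y], but the last is not
   below [e a n]. *)
exists (p ^ n.+1)%N; first by rewrite expn_gt0 prime_gt0.
split; last first.
  move=> memn; have := omega_sum_memP Sa memn (lexx _).
  by rewrite logpn ltnn.
apply: omega_sum_mem => //; first by rewrite expn_gt0 prime_gt0.
move=> i; rewrite logpn ltnS leq_eqVlt => /orP[/eqP ->//|/e_mono ni].
exact: lt_trans ny.
Qed.

(** * Cardinality and the filtration *)

Hypothesis Lreg : regular_uncountable_cardinal L.

Lemma p_span_group_card : [set: G] #= [set: L].
Proof.
have [_ _ _ Nctbl] := Lreg.
rewrite card_eq_le (injective_card_le basis_elt_inj) andbT.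
have <- : p_span_subgroup [set: L] = [set: G].
  by apply/seteqP; split=> // g _; exact: p_span_valP.
have [ctbl|//] := p_span_subgroup_small p gen [set: L].
by have [] := countable_card_lt Nctbl ctbl.
Qed.

Lemma initial_filtration : filtration initial.
Proof.
have [_ init_small _ Nctbl] := Lreg.
(* An element uses finitely many indices, so a set [P] without maximum that contains them also
   contains a strict bound. This serves both limit stages and the final union. *)
have mem_initial (P : set L) (g : G) : P !=set0 ->
    (forall b, P b -> exists2 c, P c & (b < c)%O) ->
    p_span p gen P (p_span_val g) -> exists2 b, P b & initial b g.
  move=> P0 Pnomax [s sP gs].
  have [|b Pb sb] := @seq_strict_bound _ _ P [seq u.2.1 | u <- s] P0 Pnomax.
    by move=> _ /mapP[u /sP[_ uP] ->].
  exists b => //; exists s => // u us; split; first by have [] := sP u us.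
  by rewrite itvNyE; apply: sb; exact: (map_f (fun u => u.2.1)).
split.
- exact: p_span_group_card.
- move=> a; split; first exact: p_span_subgroup_zmod.
  have [ctbl|small] := p_span_subgroup_small p gen `]-oo, a[%classic.
    exact: countable_card_lt.
  exact: card_le_lt_trans small (init_small a).
- move=> a b [_ _ ab _] g; apply: p_span_subset => x; rewrite !itvNyE => xa.
  exact: lt_trans ab.
- move=> a alim; apply/seteqP; split=> g.
    apply: mem_initial => [|b].
      by case: alim => -[b ba] _; exists b; rewrite itvNyE.
    rewrite itvNyE => /(limit_nomax alim)[c ca bc].
    by exists c; rewrite ?itvNyE.
  move=> [b]; rewrite itvNyE => ba; apply: p_span_subset => x.
  rewrite !itvNyE => xb.
  exact: lt_trans ba.
- apply/seteqP; split=> // g _.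
  have [a _] : [set: L] !=set0.
    by apply/set0P/eqP => L0; apply: Nctbl; rewrite L0; exact: countable0.
  have [| |b _ gb] := mem_initial [set: L] g _ _ (p_span_valP g).
  + by exists a.
  + by move=> b _; have [c bc] := regular_nomax Lreg b; exists c.
  + by exists b.
Qed.

End Generators.

Theorem theorem2p4 (d : Order.disp_t) (L : orderType d) (p : nat)
    (S : set L) (c A : L -> set L) :
  regular_uncountable_cardinal L ->
  prime p ->
  club_guessing S c ->
  (forall delta, S delta ->
     A delta `<=` c delta /\ order_type_omega (A delta)) ->
  exists (G : zmodType) (Gs : L -> set G),
    [/\ torsion_free G,
        homogeneous G (p_type p),
        [set: G] #= [set: L],
        filtration Gs &
        forall delta, S delta -> P_set Gs (c delta) (A delta)].
Proof.
move=> Lreg p_pr [_ c_lt _ _] AP.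
have [e eP] : {e : L -> nat -> L & forall a, S a ->
    {homo e a : m n / (m < n)%N >-> (m < n)%O} /\ A a = range (e a)}.
  apply: (@choice _ _ (fun a f => S a -> {homo f : m n / (m < n)%N >-> (m < n)%O}
    /\ A a = range f)) => a.
  (* Outside [S] a constant sequence is a dummy value, as [tail] is zero there. *)
  have [Sa|NSa] := pselect (S a); last by exists (fun=> a).
  by have [_ [f f_mono Af]] := AP a Sa; exists f.
have e_inj a : S a -> injective (e a).
  move=> /eP[e_mono _] m n emn; apply/eqP; rewrite eqn_leq; apply/andP; split;
    by rewrite leqNgt; apply/negP => /e_mono; rewrite emn ltxx.
have ec a : S a -> range (e a) `<=` c a.
  by move=> Sa; have [_ <-] := eP a Sa; have [] := AP a Sa.
have e_lt a n : S a -> (e a n < a)%O.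
  move=> Sa; have := c_lt a Sa _ (ec a Sa _ (imageT (e a) n)).
  by rewrite itvNyE.
exists (p_span_group p (gen p S e)), (@initial _ _ p S e); split.
- exact: p_span_group_torsion_free.
- exact: p_span_group_homogeneous.
- exact: p_span_group_card.
- exact: initial_filtration.
- move=> a Sa; exists (omega_sum S e p_pr a) => //.
  have [Lwo _ _ _] := Lreg; have [e_mono ->] := eP a Sa.
  by apply: Inv_omega_sum => //; exact: ec.
Qed.
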